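(* Let $X$ be a Banach space, $\mathcal{F}$ a regular thin family, $M\subseteq\mathbb{N}$ infinite, and let $(x_s)_{s\in\mathcal{F}\upharpoonright M}$ be an $\mathcal{F}$-subsequence in $X$ generating $(e_n)_n$ as an $\mathcal{F}$-spreading model. Then $(e_n)_n$ is trivial if and only if $(x_s)_{s\in\mathcal{F}\upharpoonright M}$ contains a norm convergent $\mathcal{F}$-subsequence, i.e. if and only if there exist an infinite $L\subseteq M$ and $x\in X$ such that for every $\varepsilon>0$ there is $m\in\mathbb{N}$ with $\|x_s-x\|<\varepsilon$ for all $s\in\mathcal{F}\upharpoonright L$ with $\min s\ge m$.
   Context: $\mathbb{N}=\{1,2,\dots\}$. For $M\subseteq\mathbb{N}$ infinite, $M(k)$ is its $k$-th element; for a finite set $s$, $s(k)$ is its $k$-th element; $t\sqsubseteq s$ means initial segment. For a family $\mathcal{F}$ of finite subsets of $\mathbb{N}$ let $\widehat{\mathcal{F}}=\{t:\exists s\in\mathcal{F},\ t\sqsubseteq s\}$ and $\mathcal{F}\upharpoonright M=\{s\in\mathcal{F}:s\subseteq M\}$. $\mathcal{F}$ is thin if no element is a proper initial segment of another. A family is regular if it is hereditary (closed under subsets), spreading (if $\{n_1<\dots<n_k\}$ is in it, $m_1<\dots<m_k$, $n_i\le m_i$ for all $i$, then $\{m_1,\dots,m_k\}$ is in it) and compact (its characteristic functions form a closed subset of $\{0,1\}^{\mathbb{N}}$). $\mathcal{F}$ is regular thin if it is thin and $\widehat{\mathcal{F}}$ is regular; regular thin families are assumed to contain a nonempty set. A tuple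 $(s_1,\dots,s_l)$ of nonempty finite subsets of $\mathbb{N}$ is plegma if $s_i(k)<s_j(k)$ whenever $i<j$ and $k\le\min(|s_i|,|s_j|)$, and $s_i(k)<s_j(k+1)$ for all $i,j$ and $k\le\min(|s_i|,|s_j|-1)$. An $\mathcal{F}$-subsequence $(x_s)_{s\in\mathcal{F}\upharpoonright M}$ in $X$ is a map $s\mapsto x_s$ from $\mathcal{F}\upharpoonright M$ to $X$. Let $(e_n)_n$ be a Hamel basis of an infinite-dimensional seminormed space $(E,\|\cdot\|_* )$. $(x_s)_{s\in\mathcal{F}\upharpoonright M}$ generates $(e_n)_n$ as an $\mathcal{F}$-spreading model if there is a null sequence $(\delta_n)_n$ of positive reals such that $\big|\,\|\sum_{j=1}^k a_jx_{s_j}\|-\|\sum_{j=1}^k a_je_j\|_*\big|\le\delta_l$ for all $1\le k\le l$, all plegma $k$-tuples $(s_j)_{j=1}^k$ in $\mathcal{F}\upharpoonright M$ with $s_1(1)\ge M(l)$ and all $a_1,\dots,a_k\in[-1,1]$. The sequence $(e_n)_n$ is called trivial if $\|\cdot\|_*$ is not a norm on the linear span of $(e_n)_n$. *)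

(* Defs.v *)
From HB Require Import structures.
From mathcomp Require Import all_boot all_order all_algebra finmap.
From mathcomp Require Import all_classical all_reals all_analysis.

Set Implicit Arguments.
Unset Strict Implicit.
Unset Printing Implicit Defensive.

Import Order.TTheory GRing.Theory Num.Theory.
Import numFieldNormedType.Exports.

Local Open Scope classical_set_scope.
Local Open Scope ring_scope.

(* Finite sets of naturals are [{fset nat}], arbitrary ones [set nat]. The
   natural numbers start at 1: the families and the infinite sets considered
   are required to avoid 0. *)
Definition posN : set nat := [set n | (0 < n)%N].

Definition family_on_posN (F : set {fset nat}) : Prop :=
  forall s, F s -> [set` s] `<=` posN.

(* s(k), numbered from 1; only meaningful for 1 <= k <= #|` s|. *)
Definition elt (s : {fset nat}) (k : nat) : nat :=
  nth 0%N (sort leq (enum_fset s)) k.-1.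

(* M(k), numbered from 1: the element of M having exactly k - 1 elements of M
   below it. *)
Definition elt_inf (M : set nat) (k : nat) : nat :=
  xget 0%N [set n | M n /\ (M `&` `I_n #= `I_(k.-1))%card].

Definition initial_segment (t s : {fset nat}) : Prop :=
  (t `<=` s)%fset /\
  (forall m n : nat, m \in t -> n \in s -> (n <= m)%N -> n \in t).

Definition initial_closure (F : set {fset nat}) : set {fset nat} :=
  [set t | exists s, F s /\ initial_segment t s].

Definition restrict_family (F : set {fset nat}) (M : set nat) :
  set {fset nat} := [set s | F s /\ [set` s] `<=` M].

Definition thin (F : set {fset nat}) : Prop :=
  forall s t, F s -> F t -> initial_segment t s -> t = s.

Definition hereditary (F : set {fset nat}) : Prop :=
  forall s t : {fset nat}, F s -> (t `<=` s)%fset -> F t.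

Definition spreading (F : set {fset nat}) : Prop :=
  forall s t : {fset nat}, F s -> #|` s| = #|` t| ->
    (forall i, (1 <= i <= #|` s|)%N -> (elt s i <= elt t i)%N) -> F t.

Definition char_fun (s : {fset nat}) : prod_topology (fun _ : nat => bool) :=
  fun n => n \in s.

Definition compact_family (F : set {fset nat}) : Prop :=
  closed (char_fun @` F).

Definition regular (F : set {fset nat}) : Prop :=
  [/\ hereditary F, spreading F & compact_family F].

Definition regular_thin (F : set {fset nat}) : Prop :=
  [/\ family_on_posN F, thin F, regular (initial_closure F)
    & exists2 s, F s & s != fset0].

Definition plegma (l : nat) (s : 'I_l -> {fset nat}) : Prop :=
  [/\ forall i, s i != fset0,
      forall (i j : 'I_l) (k : nat), (i < j)%N ->
        (1 <= k <= minn #|` s i| #|` s j|)%N ->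
        (elt (s i) k < elt (s j) k)%N
    & forall (i j : 'I_l) (k : nat),
        (1 <= k <= minn #|` s i| (#|` s j|).-1)%N ->
        (elt (s i) k < elt (s j) k.+1)%N].

Section SpreadingModels.
Variables (R : realType) (X : completeNormedModType R) (E : lmodType R).

Definition seminorm (p : E -> R) : Prop :=
  (forall u v, p (u + v) <= p u + p v) /\
  (forall (a : R) v, p (a *: v) = `|a| * p v).

(* Sequences (e_n)_{n >= 1} are indexed from 0: e_j is [e j.-1]. *)
Definition lin_indep (e : nat -> E) : Prop :=
  forall n (a : 'I_n -> R),
    \sum_(i < n) a i *: e i = 0 -> forall i, a i = 0.

Definition lin_span (e : nat -> E) : set E :=
  [set v | exists n (a : 'I_n -> R), v = \sum_(i < n) a i *: e i].

(* A Hamel basis indexed by nat forces E to be infinite-dimensional. *)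
Definition hamel_basis (e : nat -> E) : Prop :=
  lin_indep e /\ lin_span e = setT.

Definition trivial_seq (p : E -> R) (e : nat -> E) : Prop :=
  ~ (forall v, lin_span e v -> p v = 0 -> v = 0).

(* An F-subsequence (x_s) indexed by the members of F contained in M is a total
   function of which only the values on [restrict_family F M] are used. The
   plegma tuples below have length k.+1, so that their first member s_1
   exists; likewise delta is used at indices l >= 1 only. *)
Definition generates (F : set {fset nat}) (M : set nat) (x : {fset nat} -> X)
    (p : E -> R) (e : nat -> E) : Prop :=
  exists delta : nat -> R,
    [/\ forall n, 0 < delta n,
        delta n @[n --> \oo] --> (0 : R)
      & forall k l : nat, (k.+1 <= l)%N ->
        forall s : 'I_k.+1 -> {fset nat}, plegma s ->
        (forall j, restrict_family F M (s j)) ->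
        (elt_inf M l <= elt (s ord0) 1)%N ->
        forall a : 'I_k.+1 -> R, (forall j, -1 <= a j <= 1) ->
        `| `|\sum_(j < k.+1) a j *: x (s j)| - p (\sum_(j < k.+1) a j *: e j) |
          <= delta l].

(* [elt s 1] is min s: the empty set does not belong to a regular thin
   family. *)
Definition has_convergent_subsequence (F : set {fset nat}) (M : set nat)
    (x : {fset nat} -> X) : Prop :=
  exists L : set nat, [/\ L `<=` M, infinite_set L
    & exists x0 : X, forall eps : R, 0 < eps ->
      exists m : nat, forall s, restrict_family F L s ->
        (m <= elt s 1)%N -> `|x s - x0| < eps].

End SpreadingModels.

(* Main.v *)
Require Import Defs.
From mathcomp Require Import all_boot all_order all_algebra finmap.
From mathcomp Require Import all_classical all_reals all_analysis.
From mathcomp Require Import zify ring lra.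

(* Pass to an infinite subset of M, enumerated by f, all of whose infinite
   subsets have an initial segment in F; write T(A) for the initial segment of
   the set f(A). If the strictly increasing sequences A and B are interleaved
   (A(k) < B(k) < A(k+1)), then (T(A), T(B)) is a plegma pair, and similarly
   for longer tuples.

   If the seminorm of a nonzero combination of the e_i vanishes, moving a single
   index of a long plegma tuple gives ||e_1 - e_2||_* = 0, so that plegma pairs
   that are far out are close. To reach the tail of an arbitrary s, start from
   A = s followed by a sparse tail N and iterate A(k) |-> A(k+1) - 1:
   consecutive sequences are interleaved, and after |s| steps only N - |s|
   remains. The i-th step costs an error governed by the (i+1)-st element of s
   alone, so that these errors are summable along a sparse set however large
   |s| is. Two remainders N - |s| and N - |s'| are again interleaved, so the
   subsequence is Cauchy. Conversely, norm convergence along plegma pairs forces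
   ||e_1 - e_2||_* = 0. *)

Set Implicit Arguments.
Unset Strict Implicit.
Unset Printing Implicit Defensive.

Import Order.TTheory GRing.Theory Num.Theory.
Import numFieldNormedType.Exports.

Local Open Scope classical_set_scope.
Local Open Scope nat_scope.

(** * Initial segments of increasing sequences *)

Definition increasing (f : nat -> nat) := forall i j, i < j -> f i < f j.

Lemma increasing_step (f : nat -> nat) :
  (forall n, f n < f n.+1) -> increasing f.
Proof. move=> fS; exact: (homo_ltn ltn_trans fS). Qed.

Lemma increasing_comp (f g : nat -> nat) :
  increasing f -> increasing g -> increasing (f \o g).
Proof. by move=> fi gi i j /gi /fi. Qed.

Lemma increasing_leq (f : nat -> nat) : increasing f ->
  forall i j, i <= j -> f i <= f j.
Proof.
move=> fi i j; rewrite leq_eqVlt => /predU1P[->//|/fi]; exact: ltnW.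
Qed.

Lemma increasing_gap (f : nat -> nat) : increasing f ->
  forall i d, f i + d <= f (i + d).
Proof.
move=> fi i; elim=> [|d IH]; first by rewrite !addn0.
have := fi (i + d) (i + d).+1 (ltnSn _); rewrite addnS -addnS; lia.
Qed.

Lemma increasing_ge_id (f : nat -> nat) : increasing f -> forall i, i <= f i.
Proof. by move=> fi i; have := increasing_gap fi 0 i; rewrite add0n; lia. Qed.

Lemma infinite_unbounded (M : set nat) : infinite_set M ->
  forall n, exists2 m, M m & n <= m.
Proof.
move=> Minf n; apply: contrapT => Mn; apply: Minf.
apply: (@sub_finite_set _ _ `I_n); last exact: finite_II.
move=> m Mm /=; rewrite ltnNge; apply/negP => nm; apply: Mn.
by exists m.
Qed.

Definition seg (f : nat -> nat) (n : nat) : {fset nat} :=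
  [fset m in mkseq f n]%fset.

Lemma in_segP (f : nat -> nat) n m :
  reflect (exists2 i, i < n & m = f i) (m \in seg f n).
Proof.
rewrite inE /=; apply: (iffP mapP) => -[i].
  by rewrite mem_iota => /andP[_ ?] ->; exists i.
by move=> ? ->; exists i => //; rewrite mem_iota.
Qed.

Lemma sorted_sort_fset (s : {fset nat}) : sorted ltn (sort leq (enum_fset s)).
Proof.
by rewrite ltn_sorted_uniq_leq sort_uniq fset_uniq sort_sorted//; exact: leq_total.
Qed.

Lemma sort_seg (f : nat -> nat) n : increasing f ->
  sort leq (enum_fset (seg f n)) = mkseq f n.
Proof.
move=> fi; apply: (irr_sorted_eq ltn_trans ltnn); first exact: sorted_sort_fset.
  by apply: homo_sorted (iota_ltn_sorted 0 n) => i j; exact: fi.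
by move=> m; rewrite mem_sort inE.
Qed.

Lemma card_seg (f : nat -> nat) n : increasing f -> #|` seg f n| = n.
Proof. by move=> fi; rewrite -(size_sort leq) sort_seg ?size_mkseq. Qed.

Lemma elt_seg (f : nat -> nat) n i : increasing f -> i < n ->
  elt (seg f n) i.+1 = f i.
Proof. by move=> fi lin; rewrite /elt sort_seg//= nth_mkseq. Qed.

Lemma segS (f : nat -> nat) n : seg f n.+1 = (f n |` seg f n)%fset.
Proof.
apply/fsetP => m; rewrite in_fset1U; apply/in_segP/orP.
  case=> i; rewrite ltnS leq_eqVlt => /predU1P[->|ltin] ->; first by left.
  by right; apply/in_segP; exists i.
case=> [/eqP ->|/in_segP[i ltin ->]]; first by exists n.
by exists i => //; exact: ltnW.
Qed.

Lemma seg0 (f : nat -> nat) : seg f 0 = fset0.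
Proof. by apply/fsetP => m; rewrite inE; apply/negbTE/in_segP => -[]. Qed.

Lemma infinite_increasing_range (f : nat -> nat) :
  increasing f -> infinite_set (range f).
Proof.
move=> fi; apply/infinite_set_fsetP => n; exists (seg f n).
  by move=> _ /in_segP[i _ ->]; exists i.
by rewrite card_seg.
Qed.

Lemma seg_initial (f : nat -> nat) m n : increasing f -> m <= n ->
  initial_segment (seg f m) (seg f n).
Proof.
move=> fi lemn; split.
  by apply/fsubsetP => _ /in_segP[i ? ->]; apply/in_segP; exists i => //; lia.
move=> _ _ /in_segP[i ltim ->] /in_segP[j ltjn ->] leji.
apply/in_segP; exists j => //; case: (leqP m j) => // lemj.
by have := fi i j; lia.
Qed.

(** The lengths [n i] are arbitrary: interleaving of the whole sequences gives every inequality that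
    the plegma conditions can ask for. *)
Lemma plegma_seg k (h : 'I_k -> nat -> nat) (n : 'I_k -> nat) :
  (forall i, increasing (h i)) -> (forall i, 0 < n i) ->
  (forall (i j : 'I_k) r, i < j -> h i r < h j r) ->
  (forall i j r, h i r < h j r.+1) ->
  plegma (fun i => seg (h i) (n i)).
Proof.
move=> hi n0 hlt hS; split.
- by move=> i; rewrite -cardfs_gt0 card_seg.
- by move=> i j [|r] // ij; rewrite !card_seg// => ?; rewrite !elt_seg ?hlt //; lia.
- by move=> i j [|r] //; rewrite !card_seg// => ?; rewrite !elt_seg ?hS //; lia.
Qed.

(** * One-point extensions and infinite continuations of finite sets *)

Lemma fset_min (A : {fset nat}) : A != fset0 ->
  exists2 n, n \in A & forall m, m \in A -> n <= m.
Proof.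
case/fset0Pn => a aA; have exA : exists n, n \in A by exists a.
by case: (ex_minnP exA) => n nA nmin; exists n.
Qed.

Lemma sort_fset_max (t : {fset nat}) n : (forall m, m \in t -> m < n) ->
  sort leq (enum_fset (n |` t)%fset) = rcons (sort leq (enum_fset t)) n.
Proof.
move=> tn; apply: (irr_sorted_eq ltn_trans ltnn); first exact: sorted_sort_fset.
  have := sorted_sort_fset t.
  case: (sort leq (enum_fset t)) (mem_sort leq (enum_fset t)) => // a l al.
  rewrite rcons_cons /= rcons_path => ->.
  by apply: tn; rewrite -[_ \in _]al mem_last.
by move=> m; rewrite mem_rcons in_cons !mem_sort in_fset1U.
Qed.

(** Only the last entry of the increasing enumeration changes, and it grows. *)
Lemma spreading_replace_max (G : set {fset nat}) (t : {fset nat}) n n' :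
  spreading G -> (forall m, m \in t -> m < n) -> n <= n' ->
  G (n |` t)%fset -> G (n' |` t)%fset.
Proof.
move=> sG tn nn' /sG; apply.
  rewrite !cardfsU1; case: (boolP (n \in t)) => [/tn|];
    by case: (boolP (n' \in t)) => [/tn|]; lia.
move=> i _; rewrite /elt !sort_fset_max; last 2 first.
- by move=> m /tn; lia.
- exact: tn.
by rewrite !nth_rcons; case: ifP => // _; case: ifP.
Qed.

Lemma initial_closure_extend (F : set {fset nat}) (t : {fset nat}) :
  initial_closure F t -> ~ F t ->
  exists n, (forall m, m \in t -> m < n) /\ initial_closure F (n |` t)%fset.
Proof.
move=> [s [Fs [ts init]]] nFt.
have /fset_min[n] : (s `\` t)%fset != fset0.
  apply/eqP => /eqP; rewrite fsetD_eq0 => st; apply: nFt.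
  by rewrite (_ : t = s)//; apply/eqP; rewrite eqEfsubset ts.
rewrite inE => /andP[nt ns] nmin; exists n.
have tn m : m \in t -> m < n.
  by move=> mt; rewrite ltnNge; apply/negP => /(init _ _ mt ns); rewrite (negbTE nt).
split=> //; exists s; split=> //; split.
  by apply/fsubsetP => m; rewrite in_fset1U => /predU1P[->//|]; apply/fsubsetP.
move=> m r; rewrite !in_fset1U => /predU1P[->|mt] rs.
  move=> rn; case: (boolP (r \in t)) => [|rt]; rewrite ?orbT// orbF eqn_leq rn nmin//.
  by rewrite inE rt.
by move=> /(init _ _ mt rs) ->; rewrite orbT.
Qed.

(** Every large [c] works, so two finite sets can be continued by the same tail [c], [2c], [3c], ...
    of indices. The bound [n <= c] later keeps the number of shifts small compared with that
    tail. *)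
Lemma fset_seg_extend (q : nat -> nat) (s : {fset nat}) :
  increasing q -> [set` s] `<=` range q ->
  exists c0, forall c, c0 <= c -> exists j n,
    [/\ increasing j, n <= c, s = seg (q \o j) n
      & forall r, j (r + n) = c * r.+1].
Proof.
move=> qi sq; set t := sort leq (enum_fset s).
have memt m : (m \in t) = (m \in s) by rewrite mem_sort.
have /choice[u uP] m : exists k, m \in s -> q k = m.
  have [ms|nms] := boolP (m \in s); last by exists 0.
  by have [k _ <-] := sq m ms; exists k.
(* This exceeds both the size of [s] and all indices of its elements, so that [j] still increases
   where the multiples of [c] take over. *)
exists ((size t).+1 + \max_(m <- s) u m) => c cP.
pose j i := if i < size t then u (nth 0 t i) else c * (i - size t).+1.
have nths i : i < size t -> nth 0 t i \in s by move=> ?; rewrite -memt mem_nth.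
have uc i : i < size t -> u (nth 0 t i) < c.
  move=> /nths ms; have : u (nth 0 t i) <= \max_(m <- s) u m by exact: leq_bigmax_seq.
  lia.
exists j, (size t); split.
- apply: increasing_step => i; rewrite /j.
  case: (ltnP i.+1 (size t)) => iS.
    have iS' := ltnW iS.
    rewrite iS' ltnNge; apply/negP => /(increasing_leq qi); rewrite !uP ?nths//.
    have := sorted_sort_fset s; rewrite -/t => /(sorted_ltn_nth ltn_trans 0).
    move=> /(_ i i.+1); rewrite !inE iS iS' ltnSn => /(_ isT isT isT) /=.
    by rewrite ltnNge => /negP.
  case: (ltnP i (size t)) => il; last first.
    by rewrite subSn// ltn_mul2l; lia.
  have -> : i.+1 - size t = 0 by lia.
  by have := uc _ il; lia.
- lia.
- apply/fsetP => m; rewrite -memt; apply/(nthP 0)/in_segP => -[i it].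
    by move=> <-; exists i => //=; rewrite /j it uP// nths.
  by rewrite /= /j it uP ?nths// => ->; exists i.
- by move=> r; rewrite /j ltnNge leq_addl /= addnK.
Qed.

(** * Regular thin families *)

(** The characteristic functions of the segments converge pointwise to that of the infinite range of
    [a], which closedness would make the characteristic function of a finite set. *)
Lemma compact_family_no_branch (G : set {fset nat}) (a : nat -> nat) :
  compact_family G -> increasing a -> ~ (forall n, G (seg a n)).
Proof.
move=> cG ai Ga.
pose c : prod_topology (fun _ : nat => bool) := fun m => `[< range a m >].
have acvg : (char_fun (seg a n)) @[n --> \oo] --> c.
  apply/pointwise_cvgP => m; apply: cvg_near_cst.
  (* Since [i <= a i], a value [m] of [a] is attained at an index at most [m]. *)
  exists m.+1 => // n /= mn; rewrite /char_fun /c.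
  apply/in_segP/asboolP => [[i _ ->]|[i _ ai_m]]; first by exists i.
  exists i => //; have := increasing_ge_id ai i; lia.
have [s _ sc] : (char_fun @` G) c.
  apply: (closed_cvg _ cG _ _ acvg).
  by apply: nearW => n; exists (seg a n).
apply: (infinite_increasing_range ai); apply: (sub_finite_set _ (finite_fset s)).
move=> m am /=; have := congr1 (fun u => u m) sc.
by rewrite /char_fun /c => ->; apply/asboolP.
Qed.

Lemma increasing_selection (M : set nat) (h : nat -> nat) : infinite_set M ->
  exists f, [/\ increasing f, forall n, M (f n), h 0 <= f 0
    & forall n, h (f n).+1 <= f n.+1].
Proof.
move=> /infinite_unbounded Mu.
have /choice[pick pickP] n : exists m, M m /\ n <= m.
  by have [m Mm nm] := Mu n; exists m.
pose f := fix f n :=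
  if n is n'.+1 then pick (maxn (f n').+1 (h (f n').+1)) else pick (h 0).
have fS n : (f n).+1 <= f n.+1 /\ h (f n).+1 <= f n.+1.
  by apply/andP; rewrite -geq_max; case: (pickP (maxn (f n).+1 (h (f n).+1))).
exists f; split=> [|n||n]; last by case: (fS n).
- by apply: increasing_step => n; case: (fS n).
- by case: n => [|n] /=; [case: (pickP (h 0))|case: (pickP (maxn (f n).+1 (h (f n).+1)))].
- by case: (pickP (h 0)).
Qed.

(** An infinite subset of the range of [f] is written [f \o g]; each is required to have an initial
    segment in [F]. *)
Definition very_large (F : set {fset nat}) (f : nat -> nat) :=
  increasing f /\ forall g, increasing g -> exists n, F (seg (f \o g) n).

(** A set [t] of the closure outside [F] extends by one point and hence, by spreading, by every
    point beyond a threshold [B t]. If [f] outgrows these thresholds, a sequence in its range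
    without initial segment in [F] keeps all its segments in the closure, against compactness. *)
Lemma exists_very_large (F : set {fset nat}) (M : set nat) :
  regular_thin F -> infinite_set M ->
  exists2 f, very_large F f & forall n, M (f n).
Proof.
move=> [_ _ [_ sG cG] [s0 Fs0 _]] Minf; set G := initial_closure F in sG cG.
have /choice[B BP] (t : {fset nat}) : exists b, G t -> ~ F t ->
    forall n, b <= n -> (forall m, m \in t -> m < n) -> G (n |` t)%fset.
  have [[Gt nFt]|ntP] := pselect (G t /\ ~ F t).
    have [n [tn Gn]] := initial_closure_extend Gt nFt.
    by exists n => _ _ n' nn' _; exact: (spreading_replace_max sG tn nn' Gn).
  by exists 0 => Gt nFt; case: ntP.
(* Finitely many [t] lie below [N], so one threshold serves all of them. *)
pose C N := \max_(t <- fpowerset [fset i in iota 0 N]%fset) B t.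
have CP N (t : {fset nat}) : (forall m, m \in t -> m < N) -> B t <= C N.
  move=> tN; apply: (leq_bigmax_seq (F := B)) => //.
  rewrite fpowersetE; apply/fsubsetP => m /tN mN.
  by rewrite inE /= mem_iota.
have [f [fi fM f0 fS]] := increasing_selection C Minf.
exists f => //; split=> // g gi; apply: contrapT => nF.
have ai := increasing_comp fi gi.
apply: (compact_family_no_branch cG ai); elim=> [|n IH].
  by rewrite seg0; exists s0.
rewrite segS; apply: (BP _ IH); [by move=> Fn; apply: nF; exists n| |].
  (* If [g n] is 0 then [n] is 0 and the segment is empty; otherwise the segment lies at or below
     [f j], and [f j.+1] passes its threshold. *)
  case gn : (g n) => [|j]; rewrite /= gn.
    apply: leq_trans f0; apply: CP => m /in_segP[i lin _].
    by have := gi _ _ lin; lia.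
  apply: leq_trans (fS j); apply: CP => _ /in_segP[i lin ->].
  by rewrite ltnS /=; apply: increasing_leq => //; have := gi _ _ lin; lia.
by move=> _ /in_segP[i lin ->]; exact: ai.
Qed.

Lemma thin_seg_uniq (F : set {fset nat}) (a : nat -> nat) m n :
  thin F -> increasing a -> F (seg a m) -> F (seg a n) -> m = n.
Proof.
move=> tF ai Fm Fn; rewrite -(card_seg m ai) -(card_seg n ai); congr #|` _|.
case: (leqP m n) => [mn|/ltnW nm]; first exact: (tF _ _ Fn Fm (seg_initial ai mn)).
by symmetry; exact: (tF _ _ Fm Fn (seg_initial ai nm)).
Qed.

Lemma regular_thin_nonempty (F : set {fset nat}) : regular_thin F -> ~ F fset0.
Proof.
move=> [_ tF _ [s Fs s0]] F0; move/eqP: s0; apply; symmetry.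
exact: tF.
Qed.

Definition initial_selector (F : set {fset nat}) (f : nat -> nat)
    (T : (nat -> nat) -> {fset nat}) :=
  forall g, increasing g ->
    F (T g) /\ exists2 n, 0 < n & T g = seg (f \o g) n.

Lemma exists_initial_selector (F : set {fset nat}) (f : nat -> nat) :
  regular_thin F -> very_large F f -> exists T, initial_selector F f T.
Proof.
move=> hF [fi fP].
suff /choice[T TP] g : exists t, increasing g ->
    F t /\ exists2 n, 0 < n & t = seg (f \o g) n by exists T.
(* [fset0] is a dummy value for the sequences that are not increasing. *)
have [gi|ngi] := pselect (increasing g); last by exists fset0.
have [n Fn] := fP g gi; exists (seg (f \o g) n) => _; split=> //; exists n => //.
by case: n Fn => //; rewrite seg0 => /(regular_thin_nonempty hF).
Qed.

(** The case [i = j] of the second clause makes each [h i] increasing. *)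
Definition ord_interleaved k (h : 'I_k -> nat -> nat) :=
  (forall (i j : 'I_k) r, i < j -> h i r < h j r) /\
  (forall i j r, h i r < h j r.+1).

Definition pair_interleaved (g h : nat -> nat) :=
  (forall r, g r < h r) /\ (forall r, h r < g r.+1).

Lemma pair_interleaved_increasing g h :
  pair_interleaved g h -> increasing g /\ increasing h.
Proof.
by move=> [gh hg]; split; apply: increasing_step => r;
  [exact: ltn_trans (gh r) (hg r)|exact: ltn_trans (hg r) (gh r.+1)].
Qed.

Local Open Scope ring_scope.

(** * Spreading models along interleaved sequences *)

(** The estimate of [generates] transported to infinite sequences: [y] stands for [x \o T], and
    [m l] for the [l]-th element of [M]. *)
Definition approximates (R : realType) (X : completeNormedModType R)
    (E : lmodType R) (p : E -> R) (e : nat -> E)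
    (y : (nat -> nat) -> X) (delta : nat -> R) (m : nat -> nat) :=
  forall k l : nat, (k.+1 <= l)%N ->
  forall h : 'I_k.+1 -> nat -> nat, ord_interleaved h ->
  (m l <= h ord0 0)%N ->
  forall a : 'I_k.+1 -> R, (forall j, `|a j| <= 1) ->
  `| `|\sum_(j < k.+1) a j *: y (h j)| - p (\sum_(j < k.+1) a j *: e j) |
    <= delta l.

Lemma generates_approximates (R : realType) (X : completeNormedModType R)
    (F : set {fset nat}) (M : set nat) (x : {fset nat} -> X)
    (E : lmodType R) (p : E -> R) (e : nat -> E)
    (f : nat -> nat) (T : (nat -> nat) -> {fset nat}) :
  generates F M x p e -> increasing f -> (forall n, M (f n)) ->
  initial_selector F f T ->
  exists delta : nat -> R, exists m, [/\ forall n, 0 < delta n,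
    delta n @[n --> \oo] --> (0 : R) & approximates p e (x \o T) delta m].
Proof.
move=> [delta [dpos d0 dP]] fi fM TP; exists delta, (elt_inf M); split=> //.
move=> k l kl h [hlt hS] h0 a a1.
have hi j : increasing (h j) by apply: increasing_step => r; exact: hS.
have /choice[n nP] j : exists n, (0 < n)%N /\ T (h j) = seg (f \o h j) n.
  by have [_ [n]] := TP _ (hi j); exists n.
apply: dP => //.
- rewrite (_ : (fun j => _) = (fun j => seg (f \o h j) (n j))); last first.
    by apply/funext => j; case: (nP j).
  apply: (plegma_seg (h := fun j => f \o h j)) => [j|j|i j r ij|i j r].
  + exact: (increasing_comp fi (hi j)).
  + by case: (nP j).
  + exact: fi (hlt _ _ _ ij).
  + exact: fi.
- move=> j; have [FT [r _ rT]] := TP _ (hi j); split=> //.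
  by rewrite rT => _ /in_segP[i _ ->]; exact: fM.
- have [n0 ->] := nP ord0; rewrite elt_seg//; last exact: increasing_comp.
  exact: leq_trans h0 (increasing_ge_id fi _).
- by move=> j; rewrite -ler_norml.
Qed.

Section Approximation.
Variables (R : realType) (X : completeNormedModType R) (E : lmodType R).
Variables (p : E -> R) (e : nat -> E) (y : (nat -> nat) -> X).
Variables (delta : nat -> R) (m : nat -> nat).
Hypothesis (hp : seminorm p) (apx : approximates p e y delta m).

Lemma approximates_pair l g h : (2 <= l)%N -> pair_interleaved g h ->
  (m l <= g 0)%N -> `| `|y g - y h| - p (e 0%N - e 1%N)| <= delta l.
Proof.
move=> l2 gh g0; have [gi hi] := pair_interleaved_increasing gh.
have := apx l2 (h := fun i : 'I_2 => if i == ord0 then g else h) _ _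
  (a := fun i : 'I_2 => if i == ord0 then 1 else -1).
rewrite !big_ord_recl !big_ord0 /= !scale1r !scaleN1r !addr0; apply => //.
- case: gh => gh hg; split.
    by move=> [[|[|//]] ?] [[|[|//]] ?] r //=.
  move=> [[|[|//]] ?] [[|[|//]] ?] r //=; [exact: gi| |exact: hi].
  by apply: (ltn_trans (gh r)); apply: hi.
- by move=> j; case: ifP; rewrite ?normrN normr1.
Qed.

(** If [p] kills a combination with a nonzero coefficient at [j], the same combination of the
    [y (u i)] has norm at most [delta l], for any long interleaved tuple [u]. Moving the [j]-th
    sequence alone isolates one difference of an interleaved pair, and comparison with
    [p (e 0 - e 1)] costs one more [delta l]. *)
Lemma approximates_trivial : lin_indep e -> delta n @[n --> \oo] --> (0 : R) ->
  trivial_seq p e -> p (e 0%N - e 1%N) <= 0.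
Proof.
move=> eI d0 ptriv; have [//|Ppos] := leP (p (e 0%N - e 1%N)) 0.
case: ptriv => _ [[|n] [a ->]] pa0; first by rewrite big_ord0.
apply: big1 => j _; have [->|aj0] := eqVneq (a j) 0; first by rewrite scale0r.
exfalso.
(* Dividing by [S] brings all coefficients into [-1, 1]. *)
pose S := \sum_i `|a i|; pose b i := S^-1 * a i.
have aS i : `|a i| <= S by rewrite /S (bigD1 i)//= lerDl sumr_ge0.
have S0 : 0 < S by apply: lt_le_trans (aS j); rewrite normr_gt0.
have b1 i : `|b i| <= 1.
  by rewrite normrM gtr0_norm ?invr_gt0// mulrC ler_pdivrMr// mul1r.
have bj0 : 0 < `|b j| by rewrite normr_gt0 mulf_neq0// invr_eq0 gt_eqF.
have pb0 : p (\sum_(i < n.+1) b i *: e i) = 0.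
  under eq_bigr do rewrite -scalerA.
  by rewrite -scaler_sumr (proj2 hp) pa0 mulr0.
have key l : (n.+2 <= l)%N -> `|b j| * p (e 0%N - e 1%N) <= 3 * delta l.
  move=> nl.
  (* Blocks of length [2 * n.+1]: the tuple [u] occupies the even offsets, and [v] moves its [j]-th
     member to the free odd offset next to it. *)
  pose h (i r : nat) := (m l + 2 * n.+1 * r + i)%N.
  pose u (i : 'I_n.+1) := h (2 * i)%N.
  pose v (i : 'I_n.+1) := h (2 * i + (i == j))%N.
  have ltn2 (i : 'I_n.+1) : (2 * i + 1 < 2 * n.+1)%N by have := ltn_ord i; lia.
  have uS : `|\sum_i b i *: y (u i)| <= delta l.
    have := apx (ltnW nl) (h := u) _ _ b1; rewrite pb0 subr0 normr_id; apply.
      split=> [i i' r|i i' r]; rewrite /u /h; first lia.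
      by have := ltn2 i; rewrite mulnS; lia.
    by rewrite /u /h; lia.
  have vS : `|\sum_i b i *: y (v i)| <= delta l.
    have := apx (ltnW nl) (h := v) _ _ b1; rewrite pb0 subr0 normr_id; apply.
      split=> [i i' r|i i' r]; rewrite /v /h.
        by case: (i == j); case: (i' == j); lia.
      by have := ltn2 i; rewrite mulnS; case: (i == j); case: (i' == j); lia.
    by rewrite /v /h; lia.
  have uvE : \sum_i b i *: y (u i) - \sum_i b i *: y (v i) =
      b j *: (y (u j) - y (h (2 * j + 1)%N)).
    rewrite -sumrB (bigD1 j)//= [X in _ + X]big1 ?addr0.
      by rewrite -scalerBr /v eqxx.
    by move=> i ij; rewrite /v (negbTE ij) addn0 subrr.
  have yb : `|b j| * `|y (u j) - y (h (2 * j + 1)%N)| <= 2 * delta l.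
    rewrite -normrZ -uvE (le_trans (ler_normB _ _))//; lra.
  have : `|p (e 0%N - e 1%N) - `|y (u j) - y (h (2 * j + 1)%N)| | <= delta l.
    rewrite distrC; apply: approximates_pair; first lia.
      by split=> r; rewrite /u /h ?mulnS; have := ltn2 j; lia.
    by rewrite /u /h; lia.
  move=> /ler_normlW; rewrite lerBlDr => pd.
  have d1 : 0 <= delta l by apply: le_trans uS.
  rewrite (le_trans (ler_wpM2l (ltW bj0) pd))// mulrDr.
  have : `|b j| * delta l <= delta l by rewrite ler_piMl.
  lra.
have Q0 : 0 < `|b j| * p (e 0%N - e 1%N) / 3 by rewrite divr_gt0 ?mulr_gt0.
have /cvgrPdist_lt/(_ _ Q0) [N _ NP] := d0.
have := NP (maxn N n.+2) (leq_maxl _ _); rewrite /= sub0r normrN => dl.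
have := key (maxn N n.+2) (leq_maxr _ _).
have := le_lt_trans (ler_norm _) dl; lra.
Qed.

End Approximation.

(** * Convergence *)

Definition pair_cauchy (R : realType) (X : completeNormedModType R)
    (y : (nat -> nat) -> X) :=
  forall eps : R, 0 < eps -> exists m : nat, forall g h,
    pair_interleaved g h -> (m <= g 0)%N -> `|y g - y h| <= eps.

(* The slack [i <= k] pays for the [i] unit steps back made along a path. *)
Definition controls (R : realType) (X : completeNormedModType R)
    (y : (nat -> nat) -> X) (l : nat -> nat) :=
  (forall k, (l k + 2 <= l k.+1)%N) /\
  forall (k i : nat) g h, (i <= k)%N -> pair_interleaved g h ->
    (l k - i <= g 0)%N -> `|y g - y h| <= 2^-1 ^+ k.

(** * Distances along chains of interleaved sequences *)

Section Paths.
Variables (R : realType) (X : completeNormedModType R).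
Variables (y : (nat -> nat) -> X).

Lemma exists_controls : pair_cauchy y -> exists l, controls y l.
Proof.
move=> yC; have /choice[m mP] (k : nat) : exists m : nat, forall g h,
    pair_interleaved g h -> (m <= g 0)%N -> `|y g - y h| <= 2^-1 ^+ k.
  by apply: yC; rewrite exprn_gt0// invr_gt0.
(* Adding 2 at each stage gives [2 * k + m k <= l k], so that lowering [l k] by at most [k] stays
   above [m k]. *)
pose l := fix l k := if k is k'.+1 then (l k' + m k + 2)%N else m 0%N.
have l2 k : (2 * k + m k <= l k)%N.
  by elim: k => [|k IH] /=; lia.
exists l; split=> [k /=|k i g h ik gh g0]; first lia.
by apply: mP => //; have := l2 k; lia.
Qed.

Variable l : nat -> nat.
Hypothesis lP : controls y l.

Lemma controls_gap i d : (l i + 2 * d <= l (i + d))%N.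
Proof.
elim: d => [|d IH]; first by rewrite muln0 !addn0.
by rewrite addnS; have := proj1 lP (i + d)%N; lia.
Qed.

Lemma controls_lb i : (2 * i <= l i)%N.
Proof. by have := controls_gap 0 i; rewrite add0n; lia. Qed.

Lemma controls_increasing : increasing l.
Proof. by apply: increasing_step => k; have := proj1 lP k; lia. Qed.

(** Stage [n] of the path drops [n] terms of [l \o j] and lowers the rest by [n]. The step from
    stage [n] costs [2^-1 ^+ j n], where [j 0 + n <= j n]; the right-hand side is the partial sum of
    the geometric series. *)
Lemma shift_path_dist (j : nat -> nat) (n : nat) : increasing j ->
  `|y (l \o j) - y (fun r => (l (j (r + n)) - n)%N)| <=
    2 * (2^-1 ^+ j 0%N - 2^-1 ^+ (j 0%N + n)).
Proof.
move=> ji; elim: n => [|n IH].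
  rewrite (_ : (fun r => _) = l \o j) ?subrr ?normr0 ?addn0 ?subrr ?mulr0//.
  by apply/funext => r; rewrite addn0 subn0.
have step : `|y (fun r => (l (j (r + n)) - n)%N) -
    y (fun r => (l (j (r + n.+1)) - n.+1)%N)| <= 2^-1 ^+ j n.
  have jn := increasing_ge_id ji.
  apply: (proj2 lP) (jn n) _ _; last by rewrite add0n.
  (* The gaps and lower bounds of [l] keep the truncated subtractions exact and the inequalities
     strict. *)
  split=> r.
    have := ji (r + n)%N (r + n.+1)%N; rewrite addnS => /(_ (ltnSn _)) jr.
    have := controls_gap (j (r + n)%N) (j (r + n).+1 - j (r + n)%N).
    rewrite subnKC; last exact: ltnW.
    by have := controls_lb (j (r + n)%N); have := jn (r + n)%N; lia.
  rewrite addSnnS.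
  by have := controls_lb (j (r + n.+1)%N); have := jn (r + n.+1)%N; lia.
rewrite -(subrKA (y (fun r => (l (j (r + n)) - n)%N))).
rewrite (le_trans (ler_normD _ _))// (le_trans (lerD IH step))//.
have : 2^-1 ^+ j n <= 2^-1 ^+ (j 0%N + n) :> R.
  rewrite ler_wiXn2l ?invr_ge0// ?invf_le1 ?ler1n//.
  exact: increasing_gap ji 0 n.
rewrite addnS exprS; lra.
Qed.

(** Consecutive terms [l (c * r.+1)] are at least [2 * c] apart, so shifts by two distinct amounts
    up to [c] give an interleaved pair. *)
Lemma shifted_tails_dist (c a n n' : nat) : (0 < c)%N -> (a <= c)%N ->
  (n <= c)%N -> (n' <= c)%N ->
  `|y (fun r => (l (c * r.+1) - n)%N) - y (fun r => (l (c * r.+1) - n')%N)|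
    <= 2^-1 ^+ a.
Proof.
move=> c0 ac; wlog lenn : n n' / (n' <= n)%N => [th nc nc'|nc nc'].
  by case/orP: (leq_total n' n) => h; [|rewrite distrC]; apply: th.
move: lenn; rewrite leq_eqVlt => /predU1P[->|ltnn].
  by rewrite subrr normr0 exprn_ge0// invr_ge0.
rewrite (@le_trans _ _ (2^-1 ^+ c))//; last first.
  by rewrite ler_wiXn2l ?invr_ge0// invf_le1 ?ler1n.
apply: (proj2 lP _ _ _ _ nc); last by rewrite muln1.
split=> r; have lb := controls_lb (c * r.+1)%N;
  have cr : (c <= c * r.+1)%N by rewrite leq_pmulr.
  lia.
have := controls_gap (c * r.+1)%N c.
by rewrite [(c * r.+2)%N]mulnS (addnC c (c * r.+1)%N); lia.
Qed.

(** The constant is 5 = 2 + 1 + 2: a path from each sequence to its shifted tail, and one step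
    between the two tails. *)
Lemma common_tail_dist (j j' : nat -> nat) (a c n n' : nat) :
  increasing j -> increasing j' -> (0 < c)%N -> (a <= c)%N ->
  (n <= c)%N -> (n' <= c)%N ->
  (forall r, j (r + n)%N = (c * r.+1)%N) ->
  (forall r, j' (r + n')%N = (c * r.+1)%N) ->
  (a <= j 0)%N -> (a <= j' 0)%N ->
  `|y (l \o j) - y (l \o j')| <= 5 * 2^-1 ^+ a.
Proof.
move=> ji j'i c0 ac nc n'c jn j'n' aj aj'.
have half0 k : 0 <= 2^-1 ^+ k :> R by rewrite exprn_ge0// invr_ge0.
have halfle k : (a <= k)%N -> 2^-1 ^+ k <= 2^-1 ^+ a :> R.
  by move=> ak; rewrite ler_wiXn2l ?invr_ge0// invf_le1 ?ler1n.
have := shift_path_dist n ji; have := shift_path_dist n' j'i.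
rewrite (_ : (fun r => (l (j' (r + n')) - n')%N) =
  fun r => (l (c * r.+1) - n')%N); last first.
  by apply/funext => r; rewrite j'n'.
rewrite (_ : (fun r => (l (j (r + n)) - n)%N) =
  fun r => (l (c * r.+1) - n)%N); last first.
  by apply/funext => r; rewrite jn.
have := shifted_tails_dist c0 ac nc n'c.
set u := y (l \o j); set v := y (l \o j').
set w := y _; set w' := y _ => ww' vw' uw.
rewrite distrC in vw'.
rewrite -(subrKA w) -(subrKA w' w) (le_trans (ler_normD _ _))//.
have := ler_normD (w - w') (w' - v).
have := halfle _ aj; have := halfle _ aj'.
have := half0 (j 0 + n)%N; have := half0 (j' 0 + n')%N.
lra.
Qed.

End Paths.

(** The subset is the range of [f \o l]. Any two members of [F] in it are joined through a common
    tail, which makes a chosen sequence of members Cauchy and brings all others close to its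
    limit. *)
Lemma pair_cauchy_convergent (R : realType) (X : completeNormedModType R)
    (F : set {fset nat}) (M : set nat) (x : {fset nat} -> X)
    (f : nat -> nat) (T : (nat -> nat) -> {fset nat}) :
  regular_thin F -> increasing f -> (forall n, M (f n)) ->
  initial_selector F f T ->
  pair_cauchy (x \o T) -> has_convergent_subsequence F M x.
Proof.
move=> hF fi fM TP /exists_controls[l lP].
have li := controls_increasing lP; have fli := increasing_comp fi li.
have half0 : 0 < 2^-1 :> R by rewrite invr_gt0.
pose L := range (f \o l).
(* By thinness [T] recovers [s] from every continuation of [s], which leaves the tail free. *)
have TE s j n : F s -> increasing j -> s = seg (f \o l \o j) n -> T (l \o j) = s.
  move=> Fs ji sE; have [FT [n' _ TE]] := TP _ (increasing_comp li ji).
  rewrite TE sE; congr seg; apply: (@thin_seg_uniq F (f \o l \o j)).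
  - by case: hF.
  - exact: increasing_comp.
  - by rewrite TE in FT.
  - by rewrite -sE.
have minE s j n a : F s -> increasing j -> s = seg (f \o l \o j) n ->
    (f (l a) <= elt s 1)%N -> (a <= j 0)%N.
  move=> Fs ji sE; have n0 : (0 < n)%N.
    case: n sE => //; rewrite seg0 => s0.
    by case: (regular_thin_nonempty hF); rewrite -s0.
  rewrite sE elt_seg//; last exact: (increasing_comp fli ji).
  by rewrite leqNgt => /negP; apply: contra_notT; rewrite -ltnNge => /fli.
have dist s s' a : restrict_family F L s -> restrict_family F L s' ->
    (f (l a) <= elt s 1)%N -> (f (l a) <= elt s' 1)%N ->
    `|x s - x s'| <= 5 * 2^-1 ^+ a.
  move=> [Fs sL] [Fs' sL'] sa sa'.
  have [c1 c1P] := fset_seg_extend fli sL.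
  have [c2 c2P] := fset_seg_extend fli sL'.
  (* Large enough for both continuations, at least [a], and positive. *)
  pose c := (a + c1 + c2 + 1)%N.
  have [|j [n [ji nc sE jn]]] := c1P c; first by rewrite /c; lia.
  have [|j' [n' [j'i n'c sE' jn']]] := c2P c; first by rewrite /c; lia.
  rewrite -(TE _ _ _ Fs ji sE) -(TE _ _ _ Fs' j'i sE').
  apply: (common_tail_dist lP ji j'i _ _ nc n'c jn jn'); try by rewrite /c; lia.
  - exact: minE sE sa.
  - exact: minE sE' sa'.
(* Reference members, with minimum [f (l k)], from which the limit is obtained. *)
pose u k := T (fun i => l (k + i)%N).
have uP k : restrict_family F L (u k) /\ elt (u k) 1 = f (l k).
  have gi : increasing (fun i => l (k + i)%N).
    by move=> i i' ii'; apply: li; rewrite ltn_add2l.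
  have [FT [n n0 uE]] := TP _ gi; rewrite -/(u k) in FT uE; split.
    by split=> //; rewrite uE => _ /in_segP[i _ ->]; exists (k + i)%N.
  by rewrite uE elt_seg ?addn0//=; [rewrite addn0|exact: increasing_comp].
have fl_le a k : (a <= k)%N -> (f (l a) <= elt (u k) 1)%N.
  by rewrite (proj2 (uP k)); exact: (increasing_leq fli).
have small (eps : R) : 0 < eps -> exists a, 5 * 2^-1 ^+ a < eps.
  move=> e0; have : geometric (5 : R) 2^-1 n @[n --> \oo] --> 0.
    by apply: cvg_geometric; rewrite ger0_norm ?ltW// invf_lt1 ?ltr1n.
  move=> /cvgrPdist_lt/(_ _ e0)[N _ NP]; exists N.
  have := NP N (leqnn N); rewrite /geometric /= sub0r normrN.
  exact: le_lt_trans (ler_norm _).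
have /cauchy_cvgP/cvg_ex[x0 ux0] : cauchy ((x \o u) n @[n --> \oo]).
  apply/cauchyP => eps e0; have [a ae] := small _ e0.
  exists (x (u a)); exists a => // k ak.
  rewrite -ball_normE /=; apply: le_lt_trans ae.
  by apply: dist; rewrite ?fl_le//; case: (uP a); case: (uP k).
exists L; split.
- by move=> _ [i _ <-]; exact: fM.
- exact: infinite_increasing_range.
exists x0 => eps e0; have e20 : 0 < eps / 2 by rewrite divr_gt0.
have [a ae] := small _ e20.
have /cvgrPdist_lt/(_ _ e20)[N _ NP] := ux0.
exists (f (l a)) => s sL sa; pose k := maxn a N.
have := NP k (leq_maxr _ _); rewrite /= distrC => kx0.
have := dist s (u k) a sL (proj1 (uP k)) sa (fl_le _ _ (leq_maxl _ _)).
have := ler_normD (x s - x (u k)) (x (u k) - x0); rewrite subrKA; lra.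
Qed.

(** * The converse implication and the theorem *)

Lemma seminorm_ge0 (R : realType) (E : lmodType R) (p : E -> R) :
  seminorm p -> forall v, 0 <= p v.
Proof.
move=> [pD pZ] v; have := pD v (- v); rewrite subrr -scaleN1r pZ normrN normr1.
by have := pZ 0 v; rewrite scale0r normr0 => ->; lra.
Qed.

(** Far out in [L] both members of an interleaved pair are close to the limit, hence to each other.
    So [p] vanishes at [e 0 - e 1], which linear independence makes nonzero. *)
Lemma convergent_trivial (R : realType) (X : completeNormedModType R)
    (F : set {fset nat}) (M : set nat) (x : {fset nat} -> X)
    (E : lmodType R) (p : E -> R) (e : nat -> E) :
  regular_thin F -> seminorm p -> lin_indep e -> generates F M x p e ->
  has_convergent_subsequence F M x -> trivial_seq p e.
Proof.
move=> hF hp eI hgen [L [LM Linf [x0 x0P]]] pnorm.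
have [f [fi fP] fL] := exists_very_large hF Linf.
have [T TP] := exists_initial_selector hF (conj fi fP).
have [delta [m [_ d0 apx]]] :=
  generates_approximates hgen fi (fun n => LM _ (fL n)) TP.
have pe : p (e 0%N - e 1%N) = 0.
  apply/eqP; rewrite eq_le seminorm_ge0// andbT.
  apply/ler_addgt0Pl => eps e0; rewrite addr0.
  (* One third for each distance to the limit and one for [delta l]. *)
  have e30 : 0 < eps / 3 by rewrite divr_gt0.
  have [r rP] := x0P _ e30.
  have /cvgrPdist_lt/(_ _ e30)[N _ NP] := d0.
  (* [2 <= l] admits pairs; [b] lies beyond both the convergence threshold [r] and the threshold
     [m l]. *)
  pose l := maxn N 2; pose b := (r + m l)%N.
  pose g i := (b + 2 * i)%N; pose h i := (b + 2 * i + 1)%N.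
  have gh : pair_interleaved g h by split=> i; rewrite /g /h; lia.
  have [gi hi] := pair_interleaved_increasing gh.
  have near k : increasing k -> (r <= k 0)%N -> `|x (T k) - x0| < eps / 3.
    move=> ki rk; have [FT [n n0 TE]] := TP _ ki; apply: rP.
      by split=> //; rewrite TE => _ /in_segP[i _ ->]; exact: fL.
    rewrite TE elt_seg//; last exact: increasing_comp.
    exact: leq_trans rk (increasing_ge_id fi _).
  have := approximates_pair apx (leq_maxr N 2 : (2 <= l)%N) gh _.
  have xg := near g gi _; have xh := near h hi _.
  have := NP l (leq_maxl _ _); rewrite /= sub0r normrN => dl.
  have := le_lt_trans (ler_norm _) dl => dl'.
  have := ler_normB (x (T g) - x0) (x (T h) - x0).
  rewrite opprB addrA subrK => xgh.
  move=> /(_ _)/ler_normlP[]; first by rewrite /g /b; lia.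
  rewrite opprB /= => pe _.
  have := xg _; have := xh _; rewrite /g /h /b => /(_ ltac:(lia)) ? /(_ ltac:(lia)) ?.
  lra.
have : e 0%N - e 1%N = 0.
  apply: pnorm => //; exists 2%N, (fun i => if i == ord0 then 1 else -1).
  by rewrite !big_ord_recl big_ord0 /= scale1r scaleN1r addr0.
move=> e01; have := eI 2%N (fun i => if i == ord0 then 1 else -1) _ ord0.
rewrite !big_ord_recl big_ord0 /= scale1r scaleN1r addr0 => /(_ e01)/eqP.
by rewrite oner_eq0.
Qed.

Theorem theorem0p10 (R : realType) (X : completeNormedModType R)
  (F : set {fset nat}) (hF : regular_thin F)
  (M : set nat) (hM : M `<=` posN) (Minf : infinite_set M)
  (x : {fset nat} -> X)
  (E : lmodType R) (p : E -> R) (hp : seminorm p)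
  (e : nat -> E) (he : hamel_basis e)
  (hgen : generates F M x p e) :
  trivial_seq p e <-> has_convergent_subsequence F M x.
Proof.
have [eI _] := he; split; last exact: convergent_trivial.
move=> ptriv.
have [f [fi fP] fM] := exists_very_large hF Minf.
have [T TP] := exists_initial_selector hF (conj fi fP).
have [delta [m [_ d0 apx]]] := generates_approximates hgen fi fM TP.
have pe := approximates_trivial hp apx eI d0 ptriv.
apply: (pair_cauchy_convergent hF fi fM TP) => eps e0.
have /cvgrPdist_lt/(_ _ e0)[N _ NP] := d0.
exists (m (maxn N 2)) => g h gh g0.
(* As [p (e 0 - e 1) <= 0], the pair estimate bounds the distance by [delta] alone. *)
have := approximates_pair apx (leq_maxr N 2) gh g0.
have := NP _ (leq_maxl N 2); rewrite /= sub0r normrN => dl.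
have := le_lt_trans (ler_norm _) dl.
by move=> ? /ler_normlP[_]; lra.
Qed.
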